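(* Let $k$ be a field of characteristic $0$. Let $p\geq 2$ and let $n_0<n_1<\cdots<n_p$ be positive integers with $n_i=n_0+id$ for $i\in[1,p]$ and a fixed positive integer $d$, such that $\gcd(n_0,\dots,n_p)=1$ and $\{n_0,\dots,n_p\}$ minimally generates the numerical semigroup $\langle n_0,\dots,n_p\rangle$. Let $S=\langle (0,n_p),(n_0,n_p-n_0),(n_1,n_p-n_1),\dots,(n_{p-1},n_p-n_{p-1}),(n_p,0)\rangle\subseteq\mathbb{N}^2$, and write $n_0=ap+b$ with integers $a\ge0$, $0\leq b<p$. Then: \begin{enumerate} \item If $b=0$, $\mathrm{Der}_k(k[S])$ is minimally generated by $\left\{u\frac{\partial}{\partial u},\ t^{an_p+d}u^{(d-1)(n_p-1)}\frac{\partial}{\partial u},\ t\frac{\partial}{\partial t},\ t^{an_p-n_{p-i}+1}u^{d(n_p-i)}\frac{\partial}{\partial t}\ (1\leq i\leq p-1)\right\}$. \item If $b=1$, $\mathrm{Der}_k(k[S])$ is minimally generated by $\left\{u\frac{\partial}{\partial u},\ t^{an_p+d}u^{(d-1)(n_p-1)}\frac{\partial}{\partial u},\ t\frac{\partial}{\partial t},\ t^{an_p-n_{p-i}+1}u^{d(n_p-i)}\frac{\partial}{\partial t}\ (1\leq i\leq p)\right\}$. \item If $b\neq 0,1$, $\mathrm{Der}_k(k[S])$ is minimally generated by $\left\{u\frac{\partial}{\partial u},\ t^{(a+1)n_p+d}u^{(d-1)(n_p-1)}\frac{\partial}{\partial u},\ t\frac{\partial}{\partial t},\ t^{an_p+id+1}u^{d(n_p-i)}\frac{\partial}{\partial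 t}\ (1\leq i\leq b-1)\right\}$. \end{enumerate}
   Context: $k[S]=\bigoplus_{(s_1,s_2)\in S}k\,t^{s_1}u^{s_2}\subseteq k[t,u]$ is the semigroup ring of $S$ (first coordinate = exponent of $t$, second = exponent of $u$). $\mathrm{Der}_k(k[S])$ is the $k[S]$-module of $k$-derivations of $k[S]$; each extends uniquely to $k(t,u)$ and is written $f\frac{\partial}{\partial t}+g\frac{\partial}{\partial u}$. ''Minimally generated'' refers to a minimal generating set as a $k[S]$-module. *)

(* Defs.v *)
From mathcomp Require Import all_boot all_order all_algebra.
From mathcomp.multinomials Require Import mpoly.
Set Implicit Arguments. Unset Strict Implicit. Unset Printing Implicit Defensive.
Import GRing.Theory.
Local Open Scope ring_scope.

(* k[t,u] = {mpoly k[2]}, with t = 'X_0 and u = 'X_1. *)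

Definition nseq_ar (n0 d i : nat) : nat := (n0 + i * d)%N.

Definition inS (p n0 d : nat) (x y : nat) : Prop :=
  exists (c0 : nat) (c : 'I_p.+1 -> nat),
    x = (\sum_(i < p.+1) c i * nseq_ar n0 d i)%N /\
    y = (c0 * nseq_ar n0 d p + \sum_(i < p.+1) c i * (nseq_ar n0 d p - nseq_ar n0 d i))%N.

Definition inkS (k : fieldType) (p n0 d : nat) (f : {mpoly k[2]}) : Prop :=
  forall m, m \in msupp f -> inS p n0 d (m ord0) (m ord_max).

(* A k-derivation of k[S] (maps are taken on k[t,u], only their behaviour on
   k[S] matters). *)
Definition isDerkS (k : fieldType) (p n0 d : nat)
    (D : {mpoly k[2]} -> {mpoly k[2]}) : Prop :=
  [/\ forall x, inkS p n0 d x -> inkS p n0 d (D x),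
      forall (c : k) x y, inkS p n0 d x -> inkS p n0 d y ->
        D (c *: x + y) = c *: D x + D y
    & forall x y, inkS p n0 d x -> inkS p n0 d y ->
        D (x * y) = x * D y + y * D x].

Definition derfg (k : fieldType) (fg : {mpoly k[2]} * {mpoly k[2]})
    (h : {mpoly k[2]}) : {mpoly k[2]} :=
  fg.1 * mderiv ord0 h + fg.2 * mderiv ord_max h.

Definition generatesDer (k : fieldType) (p n0 d : nat)
    (G : seq ({mpoly k[2]} * {mpoly k[2]})) : Prop :=
  forall D, isDerkS p n0 d D ->
    exists r : 'I_(size G) -> {mpoly k[2]},
      (forall j, inkS p n0 d (r j)) /\
      forall x, inkS p n0 d x ->
        D x = \sum_(j < size G) r j * derfg (nth (0, 0) G j) x.

Definition minGenDer (k : fieldType) (p n0 d : nat)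
    (G : seq ({mpoly k[2]} * {mpoly k[2]})) : Prop :=
  [/\ forall fg, fg \in G -> isDerkS p n0 d (derfg fg),
      generatesDer p n0 d G
    & forall j : 'I_(size G), ~ generatesDer p n0 d (take j G ++ drop j.+1 G)].

Definition tu (k : fieldType) (i j : nat) : {mpoly k[2]} :=
  'X_ord0 ^+ i * 'X_ord_max ^+ j.

Definition min_gen_nsg (p n0 d : nat) : Prop :=
  forall j : 'I_p.+1,
    ~ exists c : 'I_p.+1 -> nat,
        nseq_ar n0 d j = (\sum_(i < p.+1 | i != j) c i * nseq_ar n0 d i)%N.

Definition G_case01 (k : fieldType) (p n0 d : nat) (last : nat)
    : seq ({mpoly k[2]} * {mpoly k[2]}) :=
  let np := nseq_ar n0 d p in let a := (n0 %/ p)%N in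
  [:: (0, 'X_ord_max); (0, tu k (a * np + d) ((d - 1) * (np - 1))); ('X_ord0, 0)]
  ++ [seq (tu k (a * np + 1 - nseq_ar n0 d (p - i)) (d * (np - i)), 0)
       | i <- iota 1 last].

Definition G_case2 (k : fieldType) (p n0 d : nat)
    : seq ({mpoly k[2]} * {mpoly k[2]}) :=
  let np := nseq_ar n0 d p in let a := (n0 %/ p)%N in let b := (n0 %% p)%N in
  [:: (0, 'X_ord_max); (0, tu k (a.+1 * np + d) ((d - 1) * (np - 1))); ('X_ord0, 0)]
  ++ [seq (tu k (a * np + i * d + 1) (d * (np - i)), 0) | i <- iota 1 (b - 1)].

(* Main.v *)
Require Import Defs.
From mathcomp Require Import all_boot all_order all_algebra.
From mathcomp.multinomials Require Import mpoly.
From mathcomp Require Import zify ring.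
Set Implicit Arguments. Unset Strict Implicit. Unset Printing Implicit Defensive.
Import Order.TTheory GRing.Theory Num.Theory.
Local Open Scope ring_scope.

(* A point (x, y) lies in S iff x + y = N n_p and x = j n_0 + l d with
   0 <= l <= j p and j <= N; since gcd(n_0, d) = 1, the pair (j, l) is unique up
   to multiples of (d, - n_0).

   A derivation D of k[S] is determined by D(t^{n_p}) and D(u^{n_p}), and can be
   analysed one monomial at a time: a graded piece of degree m is
   x^m (c t d/dt + e u d/du).  If m is not in S, the Cohen-Macaulay property
   forces c = 0 or e = 0, and then m + s must lie in S for every s in S off one
   of the two axes.  Writing n_0 = J p + e + 1 with 1 <= e <= p (which merges the
   three cases b = 0, b = 1, b >= 2), the pairs (j, l) show that these gaps m are
   J n_p + i d (1 <= i <= e) in the first coordinate and total degree at least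
   J + d for t d/dt, and (J + 1) n_p + d in degree J + d, up to adding multiples
   of (n_p, 0), for u d/du. *)

(** * The semigroup *)

(* [x] is the first coordinate, [N] the degree (x + y) / n_p; [x] may be negative. *)
Definition inSZ (p n0 d : nat) (x N : int) : Prop :=
  exists j l : int,
    [/\ 0 <= l, l <= j * p%:Z, j <= N & x = j * n0%:Z + l * d%:Z].

Lemma inSZ_add p n0 d x N x' N' :
  inSZ p n0 d x N -> inSZ p n0 d x' N' -> inSZ p n0 d (x + x') (N + N').
Proof.
move=> [j [l [? ? ? ->]]] [j' [l' [? ? ? ->]]].
by exists (j + j'), (l + l'); split; lia.
Qed.

Lemma inS_add p n0 d x y x' y' :
  inS p n0 d x y -> inS p n0 d x' y' -> inS p n0 d (x + x')%N (y + y')%N.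
Proof.
move=> [c0 [c [-> ->]]] [c0' [c' [-> ->]]].
exists (c0 + c0')%N, (fun i => c i + c' i)%N; split.
  by rewrite -big_split /=; apply: eq_bigr => i _; rewrite mulnDl.
rewrite [X in _ = (_ + X)%N](eq_bigr (fun i : 'I_p.+1 => c i * (nseq_ar n0 d p - nseq_ar n0 d i) +
  c' i * (nseq_ar n0 d p - nseq_ar n0 d i))%N) => [|i _]; last by rewrite /= mulnDl.
by rewrite big_split /=; lia.
Qed.

Lemma inS_u p n0 d c : inS p n0 d 0 (c * nseq_ar n0 d p)%N.
Proof. by exists c, (fun=> 0%N); split; rewrite big1 ?addn0. Qed.

Lemma inS_gen p n0 d i : (i <= p)%N ->
  inS p n0 d (nseq_ar n0 d i) (nseq_ar n0 d p - nseq_ar n0 d i)%N.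
Proof.
move=> lip; exists 0%N, (fun j : 'I_p.+1 => (j == inord i) : nat).
have sum1 F : (\sum_(j < p.+1) (j == inord i) * F j = F (inord i))%N.
  by rewrite (bigD1 (inord i)) //= eqxx mul1n big1 ?addn0 // => j /negPf->.
by rewrite !sum1 inordK.
Qed.

(** Take [j] to be the number of generators used and [l] the sum of their indices. Conversely,
    removing the generator of index [minn L p] preserves [L <= J * p], and the surplus [N - J]
    counts copies of (0, n_p). *)
Lemma inSP p n0 d x y :
  inS p n0 d x y <->
  exists2 N : nat, (x + y = N * nseq_ar n0 d p)%N & inSZ p n0 d x N.
Proof.
split=> [[c0 [c [-> ->]]]|[N xyN [j [l [l0 ljp jN xE]]]]].
  pose j := (\sum_(i < p.+1) c i)%N; pose l := (\sum_(i < p.+1) c i * i)%N.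
  have xE : (\sum_(i < p.+1) c i * nseq_ar n0 d i = j * n0 + l * d)%N.
    rewrite /j /l !big_distrl -big_split /=; apply: eq_bigr => i _.
    by rewrite /nseq_ar; lia.
  have yE : (\sum_(i < p.+1) c i * (nseq_ar n0 d p - nseq_ar n0 d i) + l * d
             = j * (p * d))%N.
    rewrite /j /l !big_distrl -big_split /=; apply: eq_bigr => i _.
    rewrite /nseq_ar subnDl -mulnBl -mulnA -mulnDr -mulnDl subnK //.
    by rewrite -ltnS.
  have ljp : (l <= j * p)%N.
    rewrite /l /j big_distrl; apply: leq_sum => i _.
    by rewrite leq_mul2l -ltnS ltn_ord orbT.
  exists (c0 + j)%N; first by rewrite xE; move: yE; rewrite /nseq_ar; nia.
  by exists j%:Z, l%:Z; split; lia.
have p0j : (0 <= j) || (p == 0%N) by nia.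
have [J [L [lJ JN xJ]]] : exists J L, [/\ L <= J * p, J <= N & x = J * n0 + L * d]%N.
  case/orP: p0j => [j0|/eqP p0]; first by exists `|j|%N, `|l|%N; split; nia.
  case: (lerP 0 j) => j0; first by exists `|j|%N, `|l|%N; split; nia.
  by exists 0%N, 0%N; split; nia.
elim: J N L x y xyN lJ JN xJ {j l l0 ljp jN xE p0j} => [|J IH] N L x y xyN lJ JN xJ.
  have [-> ->] : (x = 0 /\ y = N * nseq_ar n0 d p)%N by nia.
  exact: inS_u.
pose i := minn L p; have ip : (i <= p)%N by rewrite /i; lia.
have iL : (i <= L)%N by rewrite /i; lia.
have lJ' : (L - i <= J * p)%N by rewrite /i; lia.
have le1 : (J * n0 + (L - i) * d <= N.-1 * nseq_ar n0 d p)%N.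
  have : ((L - i) * d <= J * p * d)%N by rewrite leq_mul2r lJ' orbT.
  have : (J * nseq_ar n0 d p <= N.-1 * nseq_ar n0 d p)%N.
    by rewrite leq_mul2r; lia.
  by rewrite /nseq_ar; lia.
have := inS_add (IH N.-1 (L - i)%N (J * n0 + (L - i) * d)%N _
  (subnKC le1) lJ' _ erefl) (inS_gen n0 d ip).
have gip : (nseq_ar n0 d i <= nseq_ar n0 d p)%N by rewrite /nseq_ar; nia.
have -> : (J * n0 + (L - i) * d + nseq_ar n0 d i = x)%N.
  by rewrite xJ /nseq_ar; nia.
have -> // : (N.-1 * nseq_ar n0 d p - (J * n0 + (L - i) * d) +
         (nseq_ar n0 d p - nseq_ar n0 d i) = y)%N.
  have : (J * n0 + (L - i) * d + nseq_ar n0 d i = x)%N by rewrite xJ /nseq_ar; nia.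
  have : (N.-1 * nseq_ar n0 d p + nseq_ar n0 d p = N * nseq_ar n0 d p)%N.
    by case: N JN {xyN le1} => // N _; rewrite /= mulSn addnC.
  lia.
by apply; lia.
Qed.

Lemma rep_uniq (n0 d : nat) (j l j' l' : int) : coprime n0 d -> (0 < d)%N ->
  j * n0%:Z + l * d%:Z = j' * n0%:Z + l' * d%:Z ->
  exists r, j' = j + r * d%:Z /\ l = l' + r * n0%:Z.
Proof.
move=> co d0 E.
have : (d%:Z %| (j' - j) * n0%:Z)%Z by apply/dvdzP; exists (l - l'); lia.
rewrite Gauss_dvdzl => [/dvdzP[r rE]|]; last by rewrite coprimezE coprime_sym.
exists r; split; first by lia.
have : (l - l' - r * n0%:Z) * d%:Z = 0.
  by rewrite !mulrBl -[r * _ * _]mulrAC -rE; lia.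
by move/eqP; rewrite mulf_eq0 => /orP[/eqP|]; lia.
Qed.

(* k[S] is Cohen-Macaulay: a degree that lies in S after adding (0, n_p) and
   after adding (n_p, 0) is already in S. *)
Lemma inSZ_pred p n0 d x N :
  coprime n0 d -> (0 < d)%N -> (p < n0)%N ->
  inSZ p n0 d x N -> inSZ p n0 d (x + (nseq_ar n0 d p)%:Z) N ->
  inSZ p n0 d x (N - 1).
Proof.
move=> co d0 pn0 [j [l [l0 ljp jN xE]]] [j' [l' [l0' ljp' jN' xE']]].
have [r [rj rl]] : exists r, j' - 1 = j + r * d%:Z /\ l = l' - p%:Z + r * n0%:Z.
  by apply: rep_uniq => //; rewrite -xE; move: xE'; rewrite /nseq_ar; lia.
(* Otherwise [j = N], so [r < 0], and removing n_p from the second representation works because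
   [l' - p = l - r * n0] is nonnegative. *)
have [jN1|jN1] := lerP j (N - 1); first by exists j, l.
exists (j' - 1), (l' - p%:Z); split; try lia.
have : r < 0 by nia.
nia.
Qed.

(* The degrees of the derivations x^m t d/dt of k[S] are those m with m + s in S
   for every generator s of S except (0, n_p). *)
Lemma t_gap_class p n0 d J e x N :
  coprime n0 d -> (0 < d)%N -> (p < n0)%N ->
  n0 = (J * p + e).+1%N -> (0 < e <= p)%N ->
  (forall i, (i <= p)%N -> inSZ p n0 d (x + (nseq_ar n0 d i)%:Z) (N + 1)) ->
  inSZ p n0 d x N \/
  exists i : nat, [/\ (0 < i <= e)%N,
    x = J%:Z * (nseq_ar n0 d p)%:Z + i%:Z * d%:Z & (J + d)%N%:Z <= N].
Proof.
move=> co d0 pn0 n0E ep H.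
have [j [l [l0 ljp jN xE]]] := H 0%N isT.
rewrite /nseq_ar in xE.
have [l1|l1] := lerP l ((j - 1) * p%:Z).
  by left; exists (j - 1), l; split; lia.
have [j' [l' [l0' ljp' jN' xE']]] := H p (leqnn p).
rewrite /nseq_ar in xE'.
have [l1'|l1'] := lerP p%:Z l'.
  by left; exists (j' - 1), (l' - p%:Z); split; lia.
have [r [rj rl]] : exists r, j' = j + r * d%:Z /\ l = l' - p%:Z + r * n0%:Z.
  by apply: rep_uniq => //; lia.
have r1 : 1 <= r by nia.
(* For [r >= 2], shifting (j, l) once by (d, - n_0) still leaves [l - n0 >= 0], and the shifted
   representation allows n_0 to be removed. *)
have [r2|r2] := lerP 2 r.
  left; exists (j - 1 + d%:Z), (l - n0%:Z); split; try lia; nia.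
have rE : r = 1 by lia.
subst r; right.
(* [i0] is the least index for which [l + i0] exceeds [j * p], so the representation of x + n_{i0}
   must be a shifted one; this gives [j * p + 1 >= n0], hence [j > J]. *)
have [i0 i0E] : exists i0 : nat, j * p%:Z - l + 1 = i0%:Z.
  by exists (absz (j * p%:Z - l + 1)%R); lia.
have i0p : (i0 <= p)%N by lia.
have [j2 [l2 [l02 ljp2 jN2 xE2]]] := H i0 i0p.
rewrite /nseq_ar in xE2.
have [r [rj2 rl2]] : exists r, j2 = j + r * d%:Z /\ l + i0%:Z = l2 + r * n0%:Z.
  by apply: rep_uniq => //; lia.
have r1' : 1 <= r.
  case: (lerP 1 r) => // r0.
  have : r * (n0%:Z + d%:Z * p%:Z) <= 0 by apply: mulr_le0_ge0; lia.
  move: ljp2; rewrite rj2; lia.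
have jp1 : n0%:Z <= j * p%:Z + 1.
  have : n0%:Z <= r * n0%:Z by apply: ler_peMl.
  lia.
have jJ : J%:Z + 1 <= j.
  case: (lerP (J%:Z + 1) j) => // jJ.
  have : 0 <= (J%:Z - j) * p%:Z by apply: mulr_ge0; lia.
  lia.
have jJ' : j - 1 <= J%:Z.
  case: (lerP (j - 1) J%:Z) => // jJ'.
  have : 0 <= (j - 1 - J%:Z - 1) * p%:Z by apply: mulr_ge0; lia.
  lia.
have jE : j = J%:Z + 1 by lia.
subst j.
have [i iE] : exists i : nat, l - J%:Z * p%:Z = i%:Z.
  by exists (absz (l - J%:Z * p%:Z)%R); lia.
have {}iE : l = J%:Z * p%:Z + i%:Z by lia.
by subst l; exists i; rewrite /nseq_ar; split; lia.
Qed.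

(* Same for x^m u d/du, with (n_p, 0) excluded instead. *)
Lemma u_gap_class p n0 d J e x N :
  coprime n0 d -> (0 < d)%N -> (0 < p)%N -> (p < n0)%N ->
  n0 = (J * p + e).+1%N -> (0 < e <= p)%N ->
  inSZ p n0 d x (N + 1) ->
  (forall i, (i < p)%N -> inSZ p n0 d (x + (nseq_ar n0 d i)%:Z) (N + 1)) ->
  inSZ p n0 d x N \/
  exists M : nat, x = (J.+1 + M)%N%:Z * (nseq_ar n0 d p)%:Z + d%:Z /\
                  N = (J + d + M)%N%:Z.
Proof.
move=> co d0 p0 pn0 n0E ep [j [l [l0 ljp jN xE]]] H.
have [jN1|jN1] := lerP j N; first by left; exists j, l.
have jE : j = N + 1 by lia.
subst j.
(* Index p - 1, the largest one available, gives the strongest upper bound on [l]. *)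
have [|j2 [l2 [l02 ljp2 jN2 xE2]]] := H p.-1; first by lia.
rewrite /nseq_ar in xE2.
have [r [rj2 rl2]] : exists r, N + 2 = j2 + r * d%:Z /\
    l2 = l + p%:Z - 1 + r * n0%:Z.
  by apply: rep_uniq => //; nia.
have r1 : 1 <= r by nia.
have lr : l - 1 + r * (n0%:Z + p%:Z * d%:Z) <= (N + 1) * p%:Z.
  have j2E : j2 = N + 2 - r * d%:Z by lia.
  by move: ljp2; rewrite j2E rl2; lia.
have [lN|lN] := lerP (l + n0%:Z) ((N + 1 - d%:Z) * p%:Z).
  by left; exists (N + 1 - d%:Z), (l + n0%:Z); split; lia.
right.
(* The shifted representation misses the range by exactly one: [lN] bounds [l] from below and [lr]
   with [r >= 1] bounds it from above. *)
have lE : l + n0%:Z = (N + 1 - d%:Z) * p%:Z + 1.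
  have : n0%:Z + p%:Z * d%:Z <= r * (n0%:Z + p%:Z * d%:Z).
    by apply: ler_peMl => //; lia.
  lia.
have JM : J%:Z + 1 <= N + 1 - d%:Z.
  case: (lerP (J%:Z + 1) (N + 1 - d%:Z)) => // JN.
  have : 0 <= (J%:Z - (N + 1 - d%:Z)) * p%:Z by apply: mulr_ge0; lia.
  lia.
have [M ME] : exists M : nat, N - d%:Z - J%:Z = M%:Z.
  by exists (absz (N - d%:Z - J%:Z)%R); lia.
have {}ME : N = M%:Z + d%:Z + J%:Z by lia.
subst N.
have {}lE : l = (M%:Z + J%:Z + 1) * p%:Z + 1 - n0%:Z by lia.
by exists M; rewrite xE lE /nseq_ar; split; lia.
Qed.

(** * The gaps and their translates by generators *)

Lemma t_gap_shift p n0 d J e i i' :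
  n0 = (J * p + e).+1%N -> (0 < i <= e)%N -> (e <= p)%N -> (i' <= p)%N ->
  inSZ p n0 d (J%:Z * (nseq_ar n0 d p)%:Z + i%:Z * d%:Z + (nseq_ar n0 d i')%:Z)
    (J + d).+1%N%:Z.
Proof.
move=> n0E ie ep i'p.
have [ii'|ii'] := leqP (i + i') p.
  exists J.+1%:Z, (J * p + i + i')%N%:Z; rewrite /nseq_ar; split; lia.
(* The index sum is too large for J + 1 generators, so the pair is shifted by (d, - n_0);
   [i + i' > p >= e] keeps the new [l] nonnegative. *)
exists (J.+1 + d)%N%:Z, (i + i' - e - 1)%N%:Z; rewrite /nseq_ar; split; try lia.
nia.
Qed.

(** All representations are [(J + r * d, J * p + i - r * n0)]: the bound [l <= j * p] forces
    [r >= 1], and then [i <= e] makes [l] negative. *)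
Lemma t_gap_notin p n0 d J e i :
  coprime n0 d -> (0 < d)%N ->
  n0 = (J * p + e).+1%N -> (0 < i <= e)%N ->
  ~ inSZ p n0 d (J%:Z * (nseq_ar n0 d p)%:Z + i%:Z * d%:Z) (J + d)%N%:Z.
Proof.
move=> co d0 n0E ie [j [l [l0 ljp jN xE]]].
have [r [rj rl]] : exists r, j = J%:Z + r * d%:Z /\
    J%:Z * p%:Z + i%:Z = l + r * n0%:Z.
  by apply: rep_uniq => //; rewrite -xE /nseq_ar; lia.
have : 1 <= r by nia.
nia.
Qed.

Lemma u_gap_shift0 p n0 d J e :
  n0 = (J * p + e).+1%N -> (0 < e <= p)%N ->
  inSZ p n0 d (J.+1%:Z * (nseq_ar n0 d p)%:Z + d%:Z) (J + d).+1%N%:Z.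
Proof.
move=> n0E ep.
exists (J.+1 + d)%N%:Z, (p - e)%N%:Z; rewrite /nseq_ar; split; try lia.
have -> : (p - e)%N%:Z = p%:Z - e%:Z by lia.
by rewrite n0E; lia.
Qed.

Lemma u_gap_shift p n0 d J i : (0 < d)%N -> (i < p)%N ->
  inSZ p n0 d (J.+1%:Z * (nseq_ar n0 d p)%:Z + d%:Z + (nseq_ar n0 d i)%:Z)
    (J + d).+1%N%:Z.
Proof.
move=> d0 ip.
by exists J.+2%:Z, (J.+1 * p + 1 + i)%N%:Z; rewrite /nseq_ar; split; lia.
Qed.

(** The bound [l <= j * p] again forces [r >= 1], now in [j = J + 1 + r * d], whereas degree [J + d]
    only leaves room for [r <= 0]. *)
Lemma u_gap_notin p n0 d J :
  coprime n0 d -> (0 < d)%N ->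
  ~ inSZ p n0 d (J.+1%:Z * (nseq_ar n0 d p)%:Z + d%:Z) (J + d)%N%:Z.
Proof.
move=> co d0 [j [l [l0 ljp jN xE]]].
have [r [rj rl]] : exists r, j = J.+1%:Z + r * d%:Z /\
    J.+1%:Z * p%:Z + 1 = l + r * n0%:Z.
  by apply: rep_uniq => //; rewrite -xE /nseq_ar; lia.
have : r <= 0 by nia.
nia.
Qed.

(** * Splitting a generator off an element of S *)

Lemma inSZ_strip_t p n0 d x N : 0 < x -> inSZ p n0 d x N ->
  exists2 i, (i <= p)%N & inSZ p n0 d (x - (nseq_ar n0 d i)%:Z) (N - 1).
Proof.
move=> x0 [j [l [l0 ljp jN xE]]]; exists (minn (absz l) p); first by lia.
have j0 : 0 < j by case: (lerP j 0) => // j0; nia.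
exists (j - 1), (l - (minn (absz l) p)%:Z); rewrite /nseq_ar; split; try lia; nia.
Qed.

Lemma inSZ_strip_u p n0 d x N : (0 < p)%N -> x < N * (nseq_ar n0 d p)%:Z ->
  inSZ p n0 d x N ->
  inSZ p n0 d x (N - 1) \/
  exists2 i, (i < p)%N & inSZ p n0 d (x - (nseq_ar n0 d i)%:Z) (N - 1).
Proof.
move=> p0 x0 [j [l [l0 ljp jN xE]]].
have [jN1|jN1] := lerP j (N - 1); first by left; exists j, l.
have jE : j = N by lia.
subst j; right; exists (minn (absz l) p.-1); first by lia.
have lt : l < N * p%:Z.
  case: (ltrP l (N * p%:Z)) => // lN.
  have lE : l = N * p%:Z by lia.
  by move: x0; rewrite xE lE /nseq_ar; lia.
have N0 : 0 <= (N - 1) * p%:Z by apply: mulr_ge0 => //; nia.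
by exists (N - 1), (l - (minn (absz l) p.-1)%:Z); rewrite /nseq_ar; split; lia.
Qed.

Lemma coprime_of_gcd p n0 d :
  (\big[gcdn/0]_(i < p.+1) nseq_ar n0 d i)%N = 1%N -> coprime n0 d.
Proof.
move=> E; rewrite /coprime -dvdn1 -E; apply/dvdn_biggcdP => i _.
by rewrite dvdn_add ?dvdn_gcdl // dvdn_mull ?dvdn_gcdr.
Qed.

(** If n_0 <= p, the generator of index n_0 equals (d + 1) n_0 and is redundant. *)
Lemma ltn_of_min_gen p n0 d : (0 < n0)%N -> min_gen_nsg p n0 d -> (p < n0)%N.
Proof.
move=> n00 H; rewrite ltnNge; apply/negP => n0p.
apply: (H (inord n0)); exists (fun i => if i == ord0 then d.+1 else 0%N).
rewrite (bigD1 ord0) /=; last by rewrite -val_eqE /= inordK //; lia.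
rewrite big1 => [|i /andP[_ /negPf->]] //.
by rewrite /nseq_ar inordK //=; lia.
Qed.

(** * Derivations of k[S] *)

Definition inSm (p n0 d : nat) (m : 'X_{1..2}) : Prop :=
  inS p n0 d (m ord0) (m ord_max).

Lemma mnm2P (m m' : 'X_{1..2}) :
  m ord0 = m' ord0 -> m ord_max = m' ord_max -> m = m'.
Proof.
move=> m0 m1; apply/mnmP => -[[|[|i]] Hi] //.
  by rewrite (_ : Ordinal Hi = ord0) //; apply: val_inj.
by rewrite (_ : Ordinal Hi = ord_max) //; apply: val_inj.
Qed.

Definition var (c : bool) : 'I_2 := if c then ord_max else ord0.

(* [false] selects t ^ np and [true] selects u ^ np. *)
Definition corner (p n0 d : nat) (c : bool) : 'X_{1..2} :=
  (U_(var c) *+ nseq_ar n0 d p)%MM.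

Lemma inSm0 p n0 d : inSm p n0 d 0%MM.
Proof. by rewrite /inSm !mnm0E; have := inS_u p n0 d 0; rewrite mul0n. Qed.

Lemma inSmD p n0 d m m' :
  inSm p n0 d m -> inSm p n0 d m' -> inSm p n0 d (m + m')%MM.
Proof. by rewrite /inSm !mnmDE; apply: inS_add. Qed.

Lemma inSm_corner p n0 d c : inSm p n0 d (corner p n0 d c).
Proof.
rewrite /inSm /corner !mulmnE !mnm1E.
case: c; rewrite /= mul0n mul1n.
  by rewrite -[X in inS _ _ _ _ X]mul1n; apply: inS_u.
by rewrite -[X in inS _ _ _ _ X](subnn (nseq_ar n0 d p)); apply: inS_gen.
Qed.

(** * Monomials, coefficients and closure properties of k[S] *)

Section Coefficients.

Context (k : fieldType).
Implicit Types (x y : {mpoly k[2]}) (m : 'X_{1..2}).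

Lemma mcoeffXM m m' x : ('X_[m] * x)@_(m + m') = x@_m'.
Proof. by rewrite mulrC mcoeffMX. Qed.

Lemma mcoeffXM_neq0 m m' x : ('X_[m] * x)@_m' != 0 ->
  exists2 v, m' = (m + v)%MM & x@_v != 0.
Proof.
rewrite -mcoeff_msupp => /msuppM_le/allpairsP[[a b] /= []].
by rewrite msuppX inE => /eqP-> xb ->; exists b; rewrite // -mcoeff_msupp.
Qed.

Lemma mpolyX_neq0 m : ('X_[m] : {mpoly k[2]}) != 0.
Proof. by rewrite -msupp_eq0 msuppX. Qed.

Lemma mulrn_mpoly_eq0 n x : [pchar k] =i pred0 -> (0 < n)%N ->
  x *+ n = 0 -> x = 0.
Proof.
move=> ch n0 /eqP; rewrite -scaler_nat scaler_eq0 (pcharf0P _).1 //.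
by rewrite gtn_eqF // => /eqP.
Qed.

Lemma inkS_X p n0 d m : inSm p n0 d m -> inkS p n0 d ('X_[m] : {mpoly k[2]}).
Proof. by move=> Sm m'; rewrite msuppX inE => /eqP->. Qed.

Lemma inkS0 p n0 d : inkS p n0 d (0 : {mpoly k[2]}).
Proof. by move=> m; rewrite msupp0. Qed.

Lemma inkS1 p n0 d : inkS p n0 d (1 : {mpoly k[2]}).
Proof. by rewrite -mpolyX0; apply/inkS_X/inSm0. Qed.

Lemma inkSD p n0 d x y : inkS p n0 d x -> inkS p n0 d y -> inkS p n0 d (x + y).
Proof. by move=> Sx Sy m /msuppD_le; rewrite mem_cat => /orP[/Sx|/Sy]. Qed.

Lemma inkSZ p n0 d (c : k) x : inkS p n0 d x -> inkS p n0 d (c *: x).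
Proof. by move=> Sx m /msuppZ_le/Sx. Qed.

Lemma inkSM p n0 d x y : inkS p n0 d x -> inkS p n0 d y -> inkS p n0 d (x * y).
Proof.
move=> Sx Sy m /msuppM_le/allpairsP[[a b] /= [/Sx Sa /Sy Sb ->]].
exact: inSmD.
Qed.

Lemma inkSX p n0 d x n : inkS p n0 d x -> inkS p n0 d (x ^+ n).
Proof.
by move=> Sx; elim: n => [|n IH]; [apply: inkS1 | rewrite exprS; apply: inkSM].
Qed.

Lemma inkS_sum p n0 d (I : eqType) (r : seq I) (F : I -> {mpoly k[2]}) :
  (forall i, i \in r -> inkS p n0 d (F i)) -> inkS p n0 d (\sum_(i <- r) F i).
Proof.
elim: r => [|i r IH] SF; first by rewrite big_nil; apply: inkS0.
rewrite big_cons; apply: inkSD; first by apply: SF; rewrite mem_head.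
by apply: IH => j jr; apply: SF; rewrite inE jr orbT.
Qed.

End Coefficients.

(** Values may lie outside k[S], so every f d/dt + g d/du satisfies this before it is known to
    preserve k[S]. *)
Definition derOn (k : fieldType) (p n0 d : nat)
    (D : {mpoly k[2]} -> {mpoly k[2]}) : Prop :=
  (forall (c : k) x y, inkS p n0 d x -> inkS p n0 d y ->
     D (c *: x + y) = c *: D x + D y) /\
  (forall x y, inkS p n0 d x -> inkS p n0 d y -> D (x * y) = x * D y + y * D x).

Section Derivations.

Context (k : fieldType) (p n0 d : nat).
Implicit Types (x y : {mpoly k[2]}) (m : 'X_{1..2}) (D : {mpoly k[2]} -> {mpoly k[2]}).

Local Notation S := (inSm p n0 d).
Local Notation kS := (inkS p n0 d).
Local Notation np := (nseq_ar n0 d p).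
Local Notation e := (corner p n0 d).

Lemma derOn0 D : derOn p n0 d D -> D 0 = 0.
Proof.
move=> [lin _]; have S0 := @inkS0 k p n0 d.
have := lin 1 0 0 S0 S0; rewrite !scale1r addr0 => /esym/(canRL (addrK _)).
by rewrite subrr.
Qed.

Lemma derOn1 D : derOn p n0 d D -> D 1 = 0.
Proof.
move=> [_ leib]; have S1 := @inkS1 k p n0 d.
have := leib 1 1 S1 S1; rewrite !mul1r => /esym/(canRL (addrK _)).
by rewrite subrr.
Qed.

Lemma derOn_exp D x n : derOn p n0 d D -> kS x ->
  x * D (x ^+ n) = (x ^+ n * D x) *+ n.
Proof.
move=> hD Sx; elim: n => [|n IH]; first by rewrite derOn1 // mulr0.
have [_ leib] := hD.
rewrite exprS leib //; last exact: inkSX.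
by rewrite mulrDr IH mulrS mulrnAr addrC !mulrA.
Qed.

Lemma derOn_eqX D D' : derOn p n0 d D -> derOn p n0 d D' ->
  (forall m, S m -> D 'X_[m] = D' 'X_[m]) -> forall x, kS x -> D x = D' x.
Proof.
move=> hD hD' H x Sx; have [lin _] := hD; have [lin' _] := hD'.
have Ss m : m \in msupp x -> S m by apply: Sx.
rewrite [x]mpolyE.
elim: (msupp x) Ss => [|m s IH] Ss; first by rewrite big_nil !derOn0.
rewrite big_cons.
have Sm : S m by apply: Ss; rewrite mem_head.
have Sr m' : m' \in s -> S m' by move=> m's; apply: Ss; rewrite inE m's orbT.
have Sb : kS (\sum_(i <- s) x@_i *: 'X_[i]).
  by apply: inkS_sum => i /Sr Si; apply/inkSZ/inkS_X.
by rewrite lin ?lin' ?H ?IH //; apply: inkS_X.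
Qed.

(* Every derivation is a combination of [t d/dt] and [u d/du] with coefficients
   [D (t ^ np) / (np t ^ np)] and [D (u ^ np) / (np u ^ np)]; this is that
   statement on monomials, cleared of denominators. *)
Lemma derOn_X D m : derOn p n0 d D -> S m ->
  ('X_[e false] * 'X_[e true] * D 'X_[m]) *+ np =
  'X_[m] * (('X_[e true] * D 'X_[e false]) *+ m ord0 +
            ('X_[e false] * D 'X_[e true]) *+ m ord_max).
Proof.
move=> hD Sm; have [_ leib] := hD.
have Se c : kS ('X_[e c] : {mpoly k[2]}) by apply/inkS_X/inSm_corner.
have SX : kS ('X_[m] : {mpoly k[2]}) by apply: inkS_X.
(* The n_p-th power of ['X_[m]] is a monomial in the two corners; expanding D of it in both ways
   gives the formula after cancelling that power. *)
have XE : ('X_[m] : {mpoly k[2]}) ^+ np =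
    'X_[e false] ^+ m ord0 * 'X_[e true] ^+ m ord_max.
  rewrite !mpolyXn -mpolyXD; congr 'X_[_]; apply: mnm2P;
  by rewrite mnmDE !mulmnE !mnm1E /=; lia.
have Xn0 : ('X_[m] : {mpoly k[2]}) ^+ np != 0 by rewrite mpolyXn mpolyX_neq0.
apply: (mulfI Xn0).
have E1 := derOn_exp np hD SX.
have E2 := derOn_exp (m ord0) hD (Se false).
have E3 := derOn_exp (m ord_max) hD (Se true).
have : 'X_[e false] * 'X_[e true] * ('X_[m] * D ('X_[m] ^+ np)) =
  'X_[m] * ('X_[e true] * 'X_[e true] ^+ m ord_max * ('X_[e false] * D ('X_[e false] ^+ m ord0)) +
  'X_[e false] * 'X_[e false] ^+ m ord0 * ('X_[e true] * D ('X_[e true] ^+ m ord_max))).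
  by rewrite XE leib; [ring | apply: inkSX | apply: inkSX].
rewrite E1 E2 E3 XE => E.
transitivity ('X_[e false] * 'X_[e true] *
  (('X_[e false] ^+ m ord0 * 'X_[e true] ^+ m ord_max * D 'X_[m]) *+ np)).
  by ring.
by rewrite E; ring.
Qed.

Lemma derOn_eq0 D : [pchar k] =i pred0 -> (0 < np)%N -> derOn p n0 d D ->
  (forall c, D 'X_[e c] = 0) -> forall x, kS x -> D x = 0.
Proof.
move=> ch np0 hD De0; apply: derOn_eqX => // [|m Sm].
  by split=> *; rewrite ?scaler0 ?mulr0 addr0.
have := derOn_X hD Sm; rewrite !De0 !mulr0 !mul0rn addr0 mulr0.
move/mulrn_mpoly_eq0 => /(_ ch np0)/eqP; rewrite !mulf_eq0 !(negPf (mpolyX_neq0 _ _)) /=.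
by move/eqP.
Qed.

Lemma derfg_derOn fg : derOn p n0 d (@derfg k fg).
Proof.
split=> [c x y _ _|x y _ _]; rewrite /derfg.
  rewrite !linearP /= -!mul_mpolyC; ring.
by rewrite !mderivM; ring.
Qed.

End Derivations.

Lemma inSm_cohen_macaulay p n0 d (c : bool) (w w' : 'X_{1..2}) :
  coprime n0 d -> (0 < d)%N -> (p < n0)%N ->
  inSm p n0 d w -> inSm p n0 d w' ->
  (w + corner p n0 d (~~ c) = w' + corner p n0 d c)%MM ->
  exists2 v, inSm p n0 d v & w = (v + corner p n0 d c)%MM.
Proof.
move=> co d0 pn0.
have np0 : (0 < nseq_ar n0 d p)%N by rewrite /nseq_ar; lia.
have key v v' : inSm p n0 d v -> inSm p n0 d v' ->
    (v + corner p n0 d true = v' + corner p n0 d false)%MM ->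
    exists2 v0, inSm p n0 d v0 &
      v = (v0 + corner p n0 d false)%MM /\ v' = (v0 + corner p n0 d true)%MM.
  move=> /inSP[N vN SN] /inSP[N' vN' SN'] E.
  have E0 : (v ord0 = v' ord0 + nseq_ar n0 d p)%N.
    by move/mnmP/(_ ord0): E; rewrite !mnmDE !mulmnE !mnm1E /=; lia.
  have E1 : (v' ord_max = v ord_max + nseq_ar n0 d p)%N.
    by move/mnmP/(_ ord_max): E; rewrite !mnmDE !mulmnE !mnm1E /=; lia.
  pose v0 := (v - corner p n0 d false)%MM.
  have v00 : v0 ord0 = v' ord0 by rewrite mnmBE mulmnE mnm1E /=; lia.
  have v01 : v0 ord_max = v ord_max by rewrite mnmBE mulmnE mnm1E /=; lia.
  exists v0.
    have NN : N' = N.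
      apply/eqP; rewrite -(eqn_pmul2r np0) -vN -vN'; lia.
    subst N'; have N0 : (0 < N)%N by case: N vN' {vN SN SN'} => //; lia.
    rewrite /inSm v00 v01; apply/inSP; exists N.-1.
      by move: vN' E1; case: N N0 {vN SN SN'} => //= N _; lia.
    have := inSZ_pred co d0 pn0 SN'; rewrite -PoszD -E0 => /(_ SN).
    by congr inSZ; lia.
  by split; apply: mnm2P; rewrite mnmDE mulmnE mnm1E /= ?v00 ?v01; lia.
case: c => /= Sw Sw' E; first by have [v0 Sv0 [_ ->]] := key _ _ Sw' Sw (esym E); exists v0.
by have [v0 Sv0 [->]] := key _ _ Sw Sw' E; exists v0.
Qed.

(** * Supports of derivations and monomial derivations *)

Section Generation.

Context (k : fieldType) (p n0 d : nat).
Implicit Types (x y : {mpoly k[2]}) (m : 'X_{1..2}) (D : {mpoly k[2]} -> {mpoly k[2]}).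

Local Notation S := (inSm p n0 d).
Local Notation kS := (inkS p n0 d).
Local Notation np := (nseq_ar n0 d p).
Local Notation e := (corner p n0 d).

Hypotheses (ch0 : [pchar k] =i pred0) (co : coprime n0 d) (d0 : (0 < d)%N)
  (pn0 : (p < n0)%N).

Let np_gt0 : (0 < np)%N.
Proof. by rewrite /nseq_ar; lia. Qed.

(** Compare coefficients at [s + e (~~ c) + w] in [derOn_X]. If the other corner does not contribute
    there, characteristic 0 puts [w + s - e c] in the support of [D 'X_[s]]. If it does,
    [w + e (~~ c) = w' + e c] with [w'] in S, and the Cohen-Macaulay property already gives
    [w - e c] in S. *)
Lemma supp_der D c w s : isDerkS p n0 d D ->
  w \in msupp (D 'X_[e c]) -> S s -> (0 < s (var c))%N ->
  exists2 v, S v & (v + e c = w + s)%MM.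
Proof.
move=> [DS lin leib] wD Ss s0.
have hD : derOn p n0 d D by split.
have Se c' : kS ('X_[e c'] : {mpoly k[2]}) by apply/inkS_X/inSm_corner.
have SX : kS ('X_[s] : {mpoly k[2]}) by apply: inkS_X.
have Sw : S w by apply: (DS _ (Se c)).
have E : ('X_[e c] * ('X_[e (~~ c)] * D 'X_[s])) *+ np =
    'X_[s] * (('X_[e (~~ c)] * D 'X_[e c]) *+ s (var c) +
              ('X_[e c] * D 'X_[e (~~ c)]) *+ s (var (~~ c))).
  have := derOn_X hD Ss; case: c {wD s0} => /= {}E; last by rewrite mulrA E.
  by rewrite mulrA ['X_[e true] * _]mulrC E addrC.
have [z|] := eqVneq (('X_[e c] * D 'X_[e (~~ c)])@_(e (~~ c) + w)%MM) 0.
  have /(congr1 (fun x => x@_(s + (e (~~ c) + w))%MM)) := E.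
  rewrite mcoeffMn mcoeffXM mcoeffD !mcoeffMn z mul0rn addr0 mcoeffXM => F.
  have : ('X_[e c] * ('X_[e (~~ c)] * D 'X_[s]))@_(s + (e (~~ c) + w))%MM != 0.
    apply: contraTneq wD => z'; rewrite mcoeff_msupp negbK.
    move: F; rewrite z' mul0rn => /esym/eqP.
    by rewrite -mulr_natr mulf_eq0 (pcharf0P _).1 // [_ == 0%N]gtn_eqF // orbF.
  case/mcoeffXM_neq0 => v1 E1 /mcoeffXM_neq0[v2 E2]; rewrite -mcoeff_msupp.
  move=> /(DS _ SX) Sv2; exists v2 => //.
  apply/mnmP => i; move/mnmP/(_ i): E1; move/mnmP/(_ i): E2.
  by rewrite !mnmDE; lia.
case/mcoeffXM_neq0 => w' Ew; rewrite -mcoeff_msupp => /(DS _ (Se _)) Sw'.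
have [|v Sv ->] := @inSm_cohen_macaulay _ _ _ c w w' co d0 pn0 Sw Sw'.
  by rewrite addmC Ew addmC.
by exists (v + s)%MM; [apply: inSmD | rewrite -!addmA [(s + _)%MM]addmC].
Qed.

(** The monomial is the coefficient of the partial derivative, so the graded degree of the
    derivation is [g.2] minus one unit in the chosen variable. *)
Definition monogen (g : bool * 'X_{1..2}) : {mpoly k[2]} * {mpoly k[2]} :=
  if g.1 then (0, 'X_[g.2]) else ('X_[g.2], 0).

Lemma derfg_monogen c m x : derfg (monogen (c, m)) x = 'X_[m] * mderiv (var c) x.
Proof. by case: c; rewrite /derfg /= mul0r ?add0r ?addr0. Qed.

Lemma derfg_monogen_X c m m' :
  derfg (monogen (c, m)) 'X_[m'] = 'X_[m + (m' - U_(var c))] *+ m' (var c).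
Proof. by rewrite derfg_monogen mderivX mpolyXD scaler_nat mulrnAr. Qed.

Lemma derfg_monogen_corner c m :
  derfg (monogen (c, m)) 'X_[e c] = 'X_[m + (e c - U_(var c))] *+ np.
Proof. by rewrite derfg_monogen_X mulmnE mnm1E eqxx mul1n. Qed.

Lemma derfg_monogen_corner0 c c' m : c != c' ->
  derfg (monogen (c, m)) 'X_[e c'] = 0.
Proof.
by rewrite derfg_monogen_X mulmnE mnm1E; case: c; case: c'.
Qed.

Lemma monogen_isDer c g :
  (forall s, S s -> (0 < s (var c))%N -> S (g + (s - U_(var c)))%MM) ->
  isDerkS p n0 d (derfg (monogen (c, g))).
Proof.
move=> H; have [lin leib] := derfg_derOn p n0 d (monogen (c, g)).
split=> // x Sx; rewrite [x]mpolyE [derfg _ _]derfg_monogen raddf_sum mulr_sumr.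
apply: inkS_sum => m /Sx Sm.
rewrite /= mderivZ -scalerAr -derfg_monogen derfg_monogen_X.
have [->|m0] := posnP (m (var c)); first by rewrite mulr0n scaler0; apply: inkS0.
by rewrite -scaler_nat; do 2!apply: inkSZ; apply/inkS_X/H.
Qed.

(** [AB] stands for the pair of values of a derivation at the two corners, which determine it; the
    same coefficients must serve both. *)
Definition spanned (G : seq ({mpoly k[2]} * {mpoly k[2]}))
    (AB : bool -> {mpoly k[2]}) : Prop :=
  exists r : 'I_(size G) -> {mpoly k[2]}, (forall j, kS (r j)) /\
    forall c, AB c = \sum_(j < size G) r j * derfg (nth (0, 0) G j) 'X_[e c].

Lemma spanned0 G : spanned G (fun=> 0).
Proof.
exists (fun=> 0); split=> [j|c]; first exact: inkS0.
by rewrite big1 // => j _; rewrite mul0r.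
Qed.

Lemma spannedD G AB AB' : spanned G AB -> spanned G AB' ->
  spanned G (fun c => AB c + AB' c).
Proof.
move=> [r [Sr rE]] [r' [Sr' rE']]; exists (fun j => r j + r' j); split=> [j|c].
  exact: inkSD.
by rewrite rE rE' -big_split; apply: eq_bigr => j _; rewrite mulrDl.
Qed.

Lemma spanned_mul G fg v : fg \in G -> kS v ->
  spanned G (fun c => v * derfg fg 'X_[e c]).
Proof.
move=> fgG Sv; have iG : (index fg G < size G)%N by rewrite index_mem.
exists (fun j => if j == Ordinal iG then v else 0); split=> [j|c].
  by case: ifP => // _; apply: inkS0.
rewrite (bigD1 (Ordinal iG)) //= eqxx nth_index // big1 ?addr0 // => j /negPf->.
by rewrite mul0r.
Qed.

Lemma spanned_ext G AB AB' : AB =1 AB' -> spanned G AB -> spanned G AB'.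
Proof. by move=> E [r [Sr rE]]; exists r; split=> // c; rewrite -E. Qed.

Lemma spanned_sum G (I : eqType) (r : seq I) (F : I -> bool -> {mpoly k[2]}) :
  (forall i, i \in r -> spanned G (F i)) ->
  spanned G (fun c => \sum_(i <- r) F i c).
Proof.
elim: r => [|i r IH] SF.
  by apply: spanned_ext (spanned0 G) => c; rewrite big_nil.
apply: (@spanned_ext _ (fun c => F i c + \sum_(j <- r) F j c)) => [c|].
  by rewrite big_cons.
apply: spannedD; first by apply: SF; rewrite mem_head.
by apply: IH => j jr; apply: SF; rewrite inE jr orbT.
Qed.

(** The difference of the two sides is a derivation vanishing at both corners. *)
Lemma derOn_comb D G (r : 'I_(size G) -> {mpoly k[2]}) :
  derOn p n0 d D ->
  (forall c, D 'X_[e c] = \sum_(j < size G) r j * derfg (nth (0, 0) G j) 'X_[e c]) ->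
  forall x, kS x -> D x = \sum_(j < size G) r j * derfg (nth (0, 0) G j) x.
Proof.
move=> [lin leib] De x Sx; apply/eqP; rewrite -subr_eq0; apply/eqP.
pose E y := D y - \sum_(j < size G) r j * derfg (nth (0, 0) G j) y.
apply: (@derOn_eq0 k p n0 d E) => // [|c]; last by rewrite /E De subrr.
split=> [c y z Sy Sz|y z Sy Sz]; rewrite /E.
  rewrite lin // (eq_bigr (fun j => c *: (r j * derfg (nth (0, 0) G j) y) +
      r j * derfg (nth (0, 0) G j) z)) => [|j _].
    by rewrite big_split /= -scaler_sumr scalerBr opprD addrACA.
  by rewrite (derfg_derOn p n0 d _).1 // mulrDr scalerAr.
rewrite leib // (eq_bigr (fun j => y * (r j * derfg (nth (0, 0) G j) z) +
    z * (r j * derfg (nth (0, 0) G j) y))) => [|j _].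
  by rewrite big_split /= -!mulr_sumr !mulrBr opprD addrACA.
by rewrite (derfg_derOn p n0 d _).2 // mulrDr !mulrA ![r j * _]mulrC.
Qed.

(** * A monomial criterion for minimal generation *)

Section Criterion.

Variable L : seq (bool * 'X_{1..2}).

Hypothesis L_shift : forall c g, (c, g) \in L -> forall s, S s ->
  (0 < s (var c))%N -> S (g + (s - U_(var c)))%MM.
Hypothesis L_cover : forall c w,
  (forall s, S s -> (0 < s (var c))%N -> exists2 v, S v & (v + e c = w + s)%MM) ->
  exists g v, [/\ (c, g) \in L, S v & (v + (g + (e c - U_(var c))) = w)%MM].
Hypothesis L_antichain : forall c g g', (c, g) \in L -> (c, g') \in L ->
  g != g' -> forall v, S v -> g <> (v + g')%MM.
Hypothesis L_uniq : uniq L.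

(** Each term of [D 'X_[e c]] is matched separately: [supp_der] makes its exponent eligible for
    [L_cover], dividing by n_p fixes the scalar, and the generator found vanishes at the other
    corner. *)
Lemma monogen_generates : generatesDer p n0 d (map monogen L).
Proof.
move=> D hD; have [DS lin leib] := hD.
suff [r [Sr rE]] : spanned (map monogen L) (fun c => D 'X_[e c]).
  by exists r; split=> //; apply: derOn_comb => //; split.
pose F c (w : 'X_{1..2}) c' : {mpoly k[2]} :=
  if c == c' then (D 'X_[e c])@_w *: 'X_[w] else 0.
apply: (@spanned_ext _ (fun c' => \sum_(w <- msupp (D 'X_[e false])) F false w c' +
                                  \sum_(w <- msupp (D 'X_[e true])) F true w c')).
  by case; rewrite /F /= big1_eq ?add0r ?addr0 -mpolyE.
have FS c w : w \in msupp (D 'X_[e c]) -> spanned (map monogen L) (F c w).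
  move=> wD; have [|g [v [gL Sv wE]]] := @L_cover c w.
    by move=> s; apply: (supp_der hD wD).
  have np0 : np%:R != 0 :> k by rewrite (pcharf0P _).1 // gtn_eqF.
  have Gg : monogen (c, g) \in map monogen L by apply: map_f.
  pose a := (D 'X_[e c])@_w / np%:R.
  have Sav : kS (a *: 'X_[v]) by apply/inkSZ/inkS_X.
  apply: spanned_ext (spanned_mul Gg Sav) => c'.
  rewrite /F; case: eqVneq => [<-|cc']; last by rewrite derfg_monogen_corner0 ?mulr0.
  rewrite derfg_monogen_corner -scaler_nat -scalerAr -scalerAl -mpolyXD wE scalerA.
  by rewrite mulrC divfK.
by apply: spannedD; apply: spanned_sum => w; apply: FS.
Qed.

(** Evaluate a removed generator at its own corner and look at the single exponent that occurs.
    Generators of the other direction vanish there, and one of the same direction could only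
    contribute if [g = v + g'] with [v] in S. *)
Lemma monogen_minimal (j : 'I_(size (map monogen L))) :
  ~ generatesDer p n0 d (take j (map monogen L) ++ drop j.+1 (map monogen L)).
Proof.
set G := _ ++ _ => gen; have jL : (j < size L)%N by rewrite -(size_map monogen).
case E : (nth (false, 0%MM) L j) => [c g].
have gL : (c, g) \in L by rewrite -E mem_nth.
have [r [Sr rE]] := gen _ (monogen_isDer (L_shift gL)).
have := rE 'X_[e c] (inkS_X (inSm_corner p n0 d c)).
rewrite derfg_monogen_corner.
move/(congr1 (fun x => x@_(g + (e c - U_(var c)))%MM)).
rewrite mcoeffMn mcoeffX eqxx raddf_sum /= => sumE.
have : (\sum_(i < size G) (r i * derfg (nth (0, 0) G i) 'X_[e c])@_(g + (e c - U_(var c)))%MM) != 0.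
  by rewrite -sumE (pcharf0P _).1 // gtn_eqF.
apply/negP; rewrite negbK; apply/eqP; apply: big1 => i _; apply/eqP.
have GE : G = map monogen (take j L ++ drop j.+1 L).
  by rewrite map_cat map_take map_drop.
have : nth (0, 0) G i \in map monogen (take j L ++ drop j.+1 L).
  by rewrite -GE mem_nth.
move=> /mapP[[c' g'] gL' ->].
have [gL2 ne] : (c', g') \in L /\ (c', g') != (c, g).
  have := L_uniq; rewrite -{1}(cat_take_drop j L) (drop_nth (false, 0%MM)) // E.
  rewrite -cat_rcons cat_uniq rcons_uniq has_sym /= => /and3P[/andP[n1 _] n2 _].
  move: gL'; rewrite mem_cat => /orP[h|h].
    split; first exact: mem_take h.
    by apply: contraNneq n1 => <-.
  split; first exact: mem_drop h.
  apply: contraNneq n2 => h'; apply/hasP; exists (c, g); last by rewrite -h'.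
  by rewrite mem_rcons mem_head.
have [cc|cc] := eqVneq c' c; last by rewrite derfg_monogen_corner0 // mulr0 mcoeff0.
subst c'; rewrite derfg_monogen_corner mulrnAr mcoeffMn mulrC.
apply: contraT => nz.
have /mcoeffXM_neq0[v Ev] : ('X_[g' + (e c - U_(var c))] * r i)@_(g + (e c - U_(var c)))%MM != 0.
  by apply: contraNneq nz => ->; rewrite mul0rn.
rewrite -mcoeff_msupp => /Sr Sv; case: (@L_antichain c g g' gL gL2 _ v Sv).
  by apply: contraNneq ne => ->.
by apply: (@addIm _ (e c - U_(var c))%MM); rewrite Ev addmC addmA.
Qed.

Lemma monogen_minGen : minGenDer p n0 d (map monogen L).
Proof.
split; [|exact: monogen_generates | exact: monogen_minimal].
by move=> fg /mapP[[c g] gL ->]; apply/monogen_isDer/L_shift.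
Qed.

End Criterion.

End Generation.

(** * The generators *)

Definition mnm2 (x y : nat) : 'X_{1..2} :=
  (U_(ord0) *+ x + U_(ord_max) *+ y)%MM.

Lemma mnm2_0 x y : mnm2 x y ord0 = x.
Proof. by rewrite mnmDE !mulmnE !mnm1E /=; lia. Qed.

Lemma mnm2_1 x y : mnm2 x y ord_max = y.
Proof. by rewrite mnmDE !mulmnE !mnm1E /=; lia. Qed.

Definition mnm2E := (mnm2_0, mnm2_1, @mnmDE, @mnmBE, @mulmnE, @mnm1E).

Lemma tuE (k : fieldType) x y : tu k x y = 'X_[mnm2 x y].
Proof. by rewrite /tu !mpolyXn -mpolyXD. Qed.

Lemma inSm_inSZ p n0 d (m : 'X_{1..2}) (N : nat) : (0 < nseq_ar n0 d p)%N ->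
  (m ord0 + m ord_max = N * nseq_ar n0 d p)%N ->
  inSm p n0 d m <-> inSZ p n0 d (m ord0) N.
Proof.
move=> np0 mN; split=> [/inSP[N' mN']|SN]; last by apply/inSP; exists N.
suff -> : N' = N by [].
by apply/eqP; rewrite -(eqn_pmul2r np0) -mN -mN'.
Qed.

Lemma inSZ_bounds p n0 d x N : (0 < p)%N -> inSZ p n0 d x N ->
  [/\ 0 <= x, x <= N * (nseq_ar n0 d p)%:Z & 0 <= N].
Proof.
move=> p0 [j [l [l0 ljp jN ->]]].
have j0 : 0 <= j by nia.
have jn : 0 <= j * n0%:Z by apply: mulr_ge0.
have ld : 0 <= l * d%:Z by apply: mulr_ge0.
have lb : l * d%:Z <= j * p%:Z * d%:Z by apply: ler_wpM2r.
have jb : j * (nseq_ar n0 d p)%:Z <= N * (nseq_ar n0 d p)%:Z by apply: ler_wpM2r.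
by split; [lia | apply: le_trans jb; rewrite /nseq_ar; lia | lia].
Qed.

(** The exponents are the gaps plus one unit in the differentiated variable. The second coordinates
    bring the total degree of each gap to [(J + d) * np]. *)
Definition gens (p n0 d J e : nat) : seq (bool * 'X_{1..2}) :=
  let np := nseq_ar n0 d p in
  [:: (true, U_(ord_max)%MM); (true, mnm2 (J.+1 * np + d) ((d - 1) * (np - 1)));
      (false, U_(ord0)%MM)]
  ++ [seq (false, mnm2 (J * np + i * d + 1) (d * (np - i))) | i <- iota 1 e].

Lemma mul_predn m n : (0 < m)%N -> (0 < n)%N ->
  ((m - 1) * (n - 1) + m + n = m * n + 1)%N.
Proof. by case: m n => [|m] [|n] // _ _; rewrite !subn1 /=; lia. Qed.

(** * Verifying the criterion *)

Section Gens.

Context (p n0 d J e : nat).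
Hypotheses (co : coprime n0 d) (d0 : (0 < d)%N) (p0 : (0 < p)%N) (pn0 : (p < n0)%N)
  (n0E : n0 = (J * p + e).+1%N) (ep : (0 < e <= p)%N).

Local Notation S := (inSm p n0 d).
Local Notation np := (nseq_ar n0 d p).
Local Notation L := (gens p n0 d J e).

Let np_gt : (p < np)%N.
Proof. by rewrite /nseq_ar; lia. Qed.
Let np0 : (0 < np)%N.
Proof. by lia. Qed.

Lemma degree_u : ((d - 1) * (np - 1) + d + np = d * np + 1)%N.
Proof. exact: mul_predn. Qed.

Lemma degree_t i : (i <= e)%N -> (d * (np - i) + i * d = d * np)%N.
Proof. by move=> ie; rewrite [(i * d)%N]mulnC -mulnDr subnK //; lia. Qed.

Lemma mem_gens_u g :
  ((true, g) \in L) = (g \in [:: U_(ord_max)%MM; mnm2 (J.+1 * np + d) ((d - 1) * (np - 1))]).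
Proof.
rewrite mem_cat !inE !xpair_eqE /= orbF.
by rewrite [X in _ || X](_ : _ = false) ?orbF //; apply/mapP => -[].
Qed.

Lemma mem_gens_t g : reflect
  (g = U_(ord0)%MM \/ exists2 i, (0 < i <= e)%N & g = mnm2 (J * np + i * d + 1) (d * (np - i)))
  ((false, g) \in L).
Proof.
rewrite mem_cat !inE !xpair_eqE /=; apply: (iffP orP) => -[].
- by move/eqP; left.
- by case/mapP => i; rewrite mem_iota => ie [->]; right; exists i => //; lia.
- by move->; left.
- by move=> [i ie ->]; right; apply/mapP; exists i; rewrite // mem_iota; lia.
Qed.

Lemma gens_uniq : uniq L.
Proof.
rewrite cat_uniq; apply/and3P; split.
- rewrite /= !inE !xpair_eqE /= !andbT; apply/negP => /orP[/eqP/(congr1 (fun m : 'X_{1..2} => m ord0))|//] /=.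
  by rewrite mnm2_0 mnm1E /=; lia.
- apply/hasPn => _ /mapP[i ie ->]; rewrite mem_iota in ie.
  rewrite !inE !xpair_eqE /=; apply/negP => /eqP/(congr1 (fun m : 'X_{1..2} => m ord_max)) /=.
  by rewrite mnm2_1 mnm1E /=; nia.
- rewrite map_inj_uniq ?iota_uniq // => i i' /(congr1 (fun g : bool * 'X_{1..2} => g.2 ord0)) /=.
  by rewrite !mnm2_0 => E; apply/eqP; rewrite -(eqn_pmul2r d0); lia.
Qed.

(** A gap is not a multiple of t d/dt or u d/du because it lies outside S. Two t-gaps have equal
    total degree, so neither is a multiple of the other. *)
Lemma gens_antichain c g g' : (c, g) \in L -> (c, g') \in L ->
  g != g' -> forall v, S v -> g <> (v + g')%MM.
Proof.
move=> gL gL' gg' v Sv gE.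
have g0 := congr1 (fun m : 'X_{1..2} => m ord0) gE.
have g1 := congr1 (fun m : 'X_{1..2} => m ord_max) gE.
rewrite /= !mnmDE {gE} in g0 g1.
case: c gL gL'.
  rewrite !mem_gens_u !inE => /orP[]/eqP E /orP[]/eqP E'; subst g g'.
  - by rewrite eqxx in gg'.
  - by move: g0; rewrite mnm2_0 mnm1E /=; lia.
  - move: g0 g1; rewrite mnm2_0 mnm2_1 !mnm1E /= => g0 g1.
    have v0 : v ord0 = (J.+1 * np + d)%N by lia.
    have : inSZ p n0 d (v ord0) (J + d)%N.
      by apply/inSm_inSZ => //; move: degree_u; rewrite v0 !mulnDl; lia.
    by rewrite v0 PoszD PoszM; exact: u_gap_notin.
  - by rewrite eqxx in gg'.
move=> /mem_gens_t[E|[i ie E]] /mem_gens_t[E'|[i' ie' E']]; subst g g'.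
- by rewrite eqxx in gg'.
- by move: g1; rewrite mnm2_1 mnm1E /=; nia.
- move: g0 g1; rewrite mnm2_0 mnm2_1 !mnm1E /= => g0 g1.
  have v0 : v ord0 = (J * np + i * d)%N by lia.
  have v1 : v ord_max = (d * (np - i))%N by lia.
  have : inSZ p n0 d (v ord0) (J + d)%N.
    have ie' : (i <= e)%N by lia.
    by apply/inSm_inSZ => //; move: (degree_t ie'); rewrite v0 v1 !mulnDl; lia.
  by rewrite v0 PoszD !PoszM; exact: t_gap_notin co d0 n0E ie.
- move: g0 g1; rewrite !mnm2_0 !mnm2_1 => g0 g1; case/negP: gg'.
  have [lei lei'] : (i <= e)%N /\ (i' <= e)%N by lia.
  have := degree_t lei; have := degree_t lei'.
  have [lt|lt|-> //] := ltngtP i i'.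
    have : (i * d < i' * d)%N by rewrite ltn_mul2r d0.
    by lia.
  have : (i' * d < i * d)%N by rewrite ltn_mul2r d0.
  by lia.
Qed.

(** Split [s] into one generator involving the differentiated variable and a remainder in S; the gap
    plus that generator lies in S. *)
Lemma gens_shift c g : (c, g) \in L -> forall s, S s ->
  (0 < s (var c))%N -> S (g + (s - U_(var c)))%MM.
Proof.
case: c => /= gL s Ss s0; have /inSP[N sN SN] := Ss.
  move: gL; rewrite mem_gens_u !inE => /orP[]/eqP->.
    suff -> : (U_(ord_max) + (s - U_(ord_max)))%MM = s by [].
    by apply: mnm2P; rewrite mnmDE mnmBE !mnm1E /=; lia.
  have : inSZ p n0 d (J.+1%:Z * np%:Z + d%:Z + (s ord0)%:Z) ((J + d).+1%N%:Z + (N%:Z - 1)).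
    have [|S1|[i ip Si]] := inSZ_strip_u p0 _ SN.
    - by rewrite -PoszM -sN; lia.
    - by apply: inSZ_add S1; apply: u_gap_shift0 n0E ep.
    - have := inSZ_add (u_gap_shift n0 J d0 ip) Si.
      by congr inSZ; lia.
  have N0 : (0 < N)%N by case: N sN {SN} => //; lia.
  move=> h; apply/(@inSm_inSZ _ _ _ _ (J + d + N)) => //;
    rewrite !mnm2E /=.
    by move: degree_u; rewrite !mulnDl -sN; lia.
  by move: h; congr inSZ; lia.
move: gL => /mem_gens_t[->|[i ie ->]].
  suff -> : (U_(ord0) + (s - U_(ord0)))%MM = s by [].
  by apply: mnm2P; rewrite mnmDE mnmBE !mnm1E /=; lia.
have [|i' i'p Si] := inSZ_strip_t _ SN; first by lia.
have h := inSZ_add (t_gap_shift d n0E ie (proj2 (andP ep)) i'p) Si.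
have ie' : (i <= e)%N by lia.
apply/(@inSm_inSZ _ _ _ _ (J + d + N)) => //;
  rewrite !mnm2E /=.
  by move: (degree_t ie'); rewrite !mulnDl -sN; lia.
by move: h; congr inSZ; lia.
Qed.

Lemma gens_cover c w :
  (forall s, S s -> (0 < s (var c))%N ->
     exists2 v, S v & (v + corner p n0 d c = w + s)%MM) ->
  exists g v, [/\ (c, g) \in L, S v
                & (v + (g + (corner p n0 d c - U_(var c))) = w)%MM].
Proof.
move=> H.
have Sw : S w.
  have [|v Sv /addIm <- //] := H _ (inSm_corner p n0 d c).
  by rewrite mulmnE mnm1E eqxx; lia.
have /inSP[M wM SM] := Sw.
pose s i := mnm2 (nseq_ar n0 d i) (np - nseq_ar n0 d i).
have Ss i : (i <= p)%N -> S (s i).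
  by move=> ip; rewrite /inSm mnm2_0 mnm2_1; apply: inS_gen.
have nip i : (i <= p)%N -> (nseq_ar n0 d i <= np)%N.
  by move=> ip; rewrite /nseq_ar leq_add2l leq_mul2r ip orbT.
case: c H => /= H.
  (* For u d/du the graded degree is w minus (0, n_p): the first coordinate stays and the degree
     drops by one. *)
  have [||S1|[M' [w0E ME]]] := @u_gap_class p n0 d J e (w ord0) (M%:Z - 1) co d0 p0 pn0 n0E ep.
  - by rewrite subrK.
  - move=> i ip; rewrite subrK.
    have [||v Sv /mnmP vE] := H (s i); first by apply: Ss; lia.
      by rewrite mnm2_1 /nseq_ar subnDl -mulnBl muln_gt0; lia.
    have := nip i (ltnW ip).
    move: (vE ord0) (vE ord_max); rewrite !mnm2E /= => v0 v1 lei.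
    have -> : (w ord0)%:Z + (nseq_ar n0 d i)%:Z = (v ord0)%:Z by lia.
    by apply/inSm_inSZ => //; lia.
  - have [_ b M0] := inSZ_bounds p0 S1.
    exists U_(ord_max)%MM, (mnm2 (w ord0) (w ord_max - np)).
    have wnp : (np <= w ord_max)%N by move: wM b; lia.
    split; first by rewrite mem_gens_u mem_head.
      apply/(@inSm_inSZ _ _ _ _ M.-1); rewrite ?mnm2_0 ?mnm2_1 //.
        by case: M M0 wM {SM S1 b} => [|M] /=; lia.
      by move: S1; congr inSZ; lia.
    by apply: mnm2P; rewrite !mnm2E /=; lia.
  (* The gap exceeds the basic one by M' copies of (n_p, 0), which form the coefficient. *)
  exists (mnm2 (J.+1 * np + d) ((d - 1) * (np - 1))), (mnm2 (M' * np) 0).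
  split; first by rewrite mem_gens_u !inE eqxx orbT.
    apply/(@inSm_inSZ _ _ _ _ M'); rewrite ?mnm2_0 ?mnm2_1 ?addn0 //.
    by exists M'%:Z, (M' * p)%N%:Z; rewrite /nseq_ar; split; lia.
  have {}ME : M = (J + d + M').+1%N by lia.
  have {}w0E : w ord0 = ((J.+1 + M') * np + d)%N by lia.
  apply: mnm2P; rewrite !mnm2E /=; first by lia.
  by move: wM; rewrite w0E ME; nia.
(* For t d/dt the graded degree is w minus (n_p, 0), whose first coordinate is taken in the
   integers. *)
have [|S1|[i [ie xE NE]]] := @t_gap_class p n0 d J e ((w ord0)%:Z - np%:Z) (M%:Z - 1) co d0 pn0 n0E ep.
- move=> i ip; rewrite subrK.
  have [||v Sv /mnmP vE] := H (s i); first by apply: Ss.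
    by rewrite mnm2_0 /nseq_ar; lia.
  have := nip i ip.
  move: (vE ord0) (vE ord_max); rewrite !mnm2E /= => v0 v1 lei.
  have -> : (w ord0)%:Z - np%:Z + (nseq_ar n0 d i)%:Z = (v ord0)%:Z by lia.
  by apply/inSm_inSZ => //; lia.
- have [x0 b M0] := inSZ_bounds p0 S1.
  exists U_(ord0)%MM, (mnm2 (w ord0 - np) (w ord_max)).
  split; first by apply/mem_gens_t; left.
    apply/(@inSm_inSZ _ _ _ _ M.-1); rewrite ?mnm2_0 ?mnm2_1 //.
      by case: M M0 wM {SM S1 b} => [|M] /=; lia.
    by move: S1; congr inSZ; lia.
  by apply: mnm2P; rewrite !mnm2E /=; lia.
(* Here the surplus degree consists of copies of (0, n_p). *)
exists (mnm2 (J * np + i * d + 1) (d * (np - i))), (mnm2 0 ((M - 1 - J - d) * np)).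
split; first by apply/mem_gens_t; right; exists i.
  by rewrite /inSm mnm2_0 mnm2_1; apply: inS_u.
have [R ME] : exists R, M = (J + d + R).+1%N by exists (M - 1 - J - d)%N; lia.
have w0E : w ord0 = (J.+1 * np + i * d)%N by lia.
apply: mnm2P; rewrite !mnm2E /=; first by lia.
have -> : (M - 1 - J - d)%N = R by lia.
by move: wM; rewrite w0E ME; nia.
Qed.

End Gens.

Lemma gens_minGen (k : fieldType) (p n0 d J e : nat) : [pchar k] =i pred0 ->
  coprime n0 d -> (0 < d)%N -> (0 < p)%N -> (p < n0)%N ->
  n0 = (J * p + e).+1%N -> (0 < e <= p)%N ->
  minGenDer p n0 d (map (@monogen k) (gens p n0 d J e)).
Proof.
move=> ch co d0 p0 pn0 n0E ep; apply: monogen_minGen => //.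
- exact: gens_shift.
- exact: gens_cover.
- exact: gens_antichain.
- exact: gens_uniq.
Qed.

Theorem theorem4p5 (k : fieldType) (p n0 d : nat) :
  [pchar k] =i pred0 ->
  (2 <= p)%N -> (0 < n0)%N -> (0 < d)%N ->
  (\big[gcdn/0]_(i < p.+1) nseq_ar n0 d i)%N = 1%N ->
  min_gen_nsg p n0 d ->
  [/\ (n0 %% p = 0)%N -> minGenDer p n0 d (G_case01 k p n0 d (p - 1)),
      (n0 %% p = 1)%N -> minGenDer p n0 d (G_case01 k p n0 d p)
    & (n0 %% p != 0)%N -> (n0 %% p != 1)%N -> minGenDer p n0 d (G_case2 k p n0 d)].
Proof.
move=> ch p2 n0_gt0 d0 /coprime_of_gcd co /(ltn_of_min_gen n0_gt0) pn0.
have p0 : (0 < p)%N by lia.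
have n0E := divn_eq n0 p.
have a0 : (0 < n0 %/ p)%N by rewrite divn_gt0 // ltnW.
(* For b = 0 and b = 1 take J = a - 1, with e = p - 1 and e = p respectively. Positivity of a also
   makes the subtraction in the exponents of [G_case01] exact. *)
have case01 e : n0 = ((n0 %/ p).-1 * p + e).+1%N -> (0 < e <= p)%N ->
    minGenDer p n0 d (G_case01 k p n0 d e).
  move=> eE ep; have := gens_minGen ch co d0 p0 pn0 eE ep.
  congr minGenDer; rewrite /gens map_cat /G_case01 /= /monogen /= !tuE prednK //.
  congr [:: _, _, _ & _]; rewrite -map_comp; apply/eq_in_map => i.
  rewrite mem_iota => ie /=; rewrite tuE; congr ('X_[mnm2 _ _], _).
  by case: (n0 %/ p)%N a0 => // a _; rewrite /nseq_ar /=; nia.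
split=> [b|b|b0 b1].
- by apply: case01; case: (n0 %/ p)%N a0 n0E => // a _ /=; lia.
- by apply: case01; case: (n0 %/ p)%N a0 n0E => // a _ /=; lia.
(* For b >= 2 the parameters are J = a and e = b - 1. *)
have eE : n0 = (n0 %/ p * p + (n0 %% p - 1)).+1%N by lia.
have ep : (0 < n0 %% p - 1 <= p)%N by have := ltn_pmod n0 p0; lia.
have := gens_minGen ch co d0 p0 pn0 eE ep.
congr minGenDer; rewrite /gens map_cat /G_case2 /= /monogen /= !tuE.
congr [:: _, _, _ & _]; rewrite -map_comp; apply/eq_in_map => i _ /=.
by rewrite tuE.
Qed.
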